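(* Let $\frac1p+\frac1q=1$. For any $0<\epsilon<\mathrm{diam}_p^p(\underline S)\,\lambda$, Algorithm 6 (described in the context), with either the Jacobian or the MBI updating rule, finds an $\epsilon$-stationary point of the multi-block problem $\min\{\Phi(x):x_i\in S_i,\ i=1,\dots,d\}$ within $$N=\left\lceil\frac{2(\mathrm{diam}_p(\overline S)^p\,\lambda)^{q-1}(\Phi(x^1)-\Phi^* )}{\epsilon^q}\right\rceil$$ steps; that is, for every sequence $(x^k)_{k\ge1}$ generated by the algorithm there is an index $1\le k\le\max\{1,N\}$ such that $x^k$ is an $\epsilon$-stationary point.
   Context: Let $S_i\subseteq\mathbf R^{n_i}$ ($i=1,\dots,d$) be nonempty, convex and compact, $S=\prod_{i=1}^dS_i$, $x=(x_1,\dots,x_d)$ with blocks $x_i\in\mathbf R^{n_i}$. $f$ is a differentiable (possibly nonconvex) real-valued function on $\mathbf R^{n_1}\times\dots\times\mathbf R^{n_d}$, $\nabla_if$ its gradient with respect to block $x_i$, and each $h_i:\mathbf R^{n_i}\to\mathbf R$ is convex (possibly nonsmooth). $\Phi(x)=f(x_1,\dots,x_d)+\sum_{i=1}^dh_i(x_i)$ and $\Phi^*=\min_{x\in S}\Phi(x)$. $\|v\|_p=(\sum_j|v_j|^p)^{1/p}$; $\mathrm{diam}_p(\overline S)=\max_{1\le i\le d}\max_{x_i,y_i\in S_i}\|x_i-y_i\|_p$; $\mathrm{diam}_p(\underline S)=\min_{1\le i\le d}\max_{x_i,y_i\in S_i}\|x_i-y_i\|_p$; $\mathrm{diam}_p^p(\cdot)$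 is the $p$-th power of $\mathrm{diam}_p(\cdot)$. Standing assumption: $p>1$, $\lambda>0$ are such that $f(y)\le f(x)+\nabla f(x)^{\top}(y-x)+\frac{\lambda}{2}\|y-x\|_p^p$ for all $x,y\in S$. A point $x\in S$ is an $\epsilon$-stationary point of the multi-block problem if $\nabla_if(x)^{\top}(y_i-x_i)+h_i(y_i)-h_i(x_i)\ge-\epsilon$ for all $y_i\in S_i$ and all $i=1,\dots,d$. Let $U_i(x_i;z)=f(z)+\nabla_if(z)^{\top}(x_i-z_i)+\frac{\lambda}{2}\|x_i-z_i\|_p^p+h_i(x_i)$. Algorithm 6: start from $x^1\in S$. For $k=1,2,\dots$: for each $i$ let $y_i^{k+1}=\arg\min_{y_i\in S_i}U_i(y_i;x^k)$ and $\triangle_iU_k=U_i(x_i^k;x^k)-U_i(y_i^{k+1};x^k)$. Jacobian rule: $x_i^{k+1}=y_i^{k+1}$ for all $i$. MBI (maximum block improvement) rule: choose $i_0\in\arg\max_i\triangle_iU_k$, set $x_{i_0}^{k+1}=y_{i_0}^{k+1}$ and $x_i^{k+1}=x_i^k$ for $i\ne i_0$. *)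

(* Defs.v *)
From mathcomp Require Import all_boot all_order all_algebra.
From mathcomp Require Import all_classical all_reals all_analysis.

Set Implicit Arguments.
Unset Strict Implicit.
Unset Printing Implicit Defensive.

Import Order.TTheory GRing.Theory Num.Theory.
Import numFieldNormedType.Exports.

Local Open Scope classical_set_scope.
Local Open Scope ring_scope.

(* R^{n_1} x ... x R^{n_d}: row vectors whose i-th block is [submxrow x i]
   (blocks are indexed by 0, ..., d-1). *)
Notation blockvec R n := 'rV[R]_(\sum_i n i).

Definition dotp (R : realType) (m : nat) (u v : 'rV[R]_m) : R :=
  \sum_j u 0 j * v 0 j.

Definition pnorm (R : realType) (p : R) (m : nat) (v : 'rV[R]_m) : R :=
  (\sum_j `|v 0 j| `^ p) `^ p^-1.

Definition grad (R : realType) (m : nat) (f : 'rV[R]_m -> R) (x : 'rV[R]_m) :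
    'rV[R]_m :=
  \row_j 'D_(delta_mx 0 j) f x.

Definition block_grad (R : realType) (d : nat) (n : 'I_d -> nat)
    (f : blockvec R n -> R) (i : 'I_d) (x : blockvec R n) : 'rV[R]_(n i) :=
  submxrow (grad f x) i.

Definition prod_set (R : realType) (d : nat) (n : 'I_d -> nat)
    (S : forall i, set 'rV[R]_(n i)) : set (blockvec R n) :=
  [set x | forall i, S i (submxrow x i)].

(* The set is bounded when A is compact, and the supremum is then attained. *)
Definition diam (R : realType) (p : R) (m : nat) (A : set 'rV[R]_m) : R :=
  sup [set pnorm p (x - y) | x in A & y in A].

(* Diameters are nonnegative, so starting the iterated max at 0 is harmless. *)
Definition diam_upper (R : realType) (p : R) (d : nat) (n : 'I_d -> nat)
    (S : forall i, set 'rV[R]_(n i)) : R :=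
  \big[Num.max/0]_(i < d) diam p (S i).

(* The start value is at least every term, so for d > 0 this is the min. *)
Definition diam_lower (R : realType) (p : R) (d : nat) (n : 'I_d -> nat)
    (S : forall i, set 'rV[R]_(n i)) : R :=
  \big[Num.min/diam_upper p S]_(i < d) diam p (S i).

Definition Phi (R : realType) (d : nat) (n : 'I_d -> nat)
    (f : blockvec R n -> R) (h : forall i, 'rV[R]_(n i) -> R)
    (x : blockvec R n) : R :=
  f x + \sum_(i < d) h i (submxrow x i).

(* Attained when f is differentiable, the h i are convex (hence continuous) and
   the S i are nonempty and compact. *)
Definition Phi_star (R : realType) (d : nat) (n : 'I_d -> nat)
    (S : forall i, set 'rV[R]_(n i)) (f : blockvec R n -> R)
    (h : forall i, 'rV[R]_(n i) -> R) : R :=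
  inf (Phi f h @` prod_set S).

Definition descent_bound (R : realType) (p lambda : R) (d : nat)
    (n : 'I_d -> nat) (S : forall i, set 'rV[R]_(n i))
    (f : blockvec R n -> R) : Prop :=
  forall x y, prod_set S x -> prod_set S y ->
    f y <= f x + dotp (grad f x) (y - x)
           + lambda / 2 * pnorm p (y - x) `^ p.

Definition stationary (R : realType) (d : nat) (n : 'I_d -> nat)
    (S : forall i, set 'rV[R]_(n i)) (f : blockvec R n -> R)
    (h : forall i, 'rV[R]_(n i) -> R) (eps : R) (x : blockvec R n) : Prop :=
  prod_set S x /\
  forall i (y : 'rV[R]_(n i)), S i y ->
    - eps <= dotp (block_grad f i x) (y - submxrow x i)
             + h i y - h i (submxrow x i).

Definition surrogate (R : realType) (p lambda : R) (d : nat) (n : 'I_d -> nat)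
    (f : blockvec R n -> R) (h : forall i, 'rV[R]_(n i) -> R)
    (i : 'I_d) (y : 'rV[R]_(n i)) (z : blockvec R n) : R :=
  f z + dotp (block_grad f i z) (y - submxrow z i)
  + lambda / 2 * pnorm p (y - submxrow z i) `^ p + h i y.

Definition argmin (R : realType) (T : Type) (A : set T) (F : T -> R) : set T :=
  [set y | A y /\ forall z, A z -> F y <= F z].

Definition argmax (R : realType) (T : Type) (A : set T) (F : T -> R) : set T :=
  [set y | A y /\ forall z, A z -> F z <= F y].

Inductive update_rule := Jacobian | MBI.

(* One iteration, from z = x^k to z' = x^{k+1}; y = y^{k+1} collects the block
   minimizers. *)
Definition iteration (R : realType) (rule : update_rule) (p lambda : R)
    (d : nat) (n : 'I_d -> nat) (S : forall i, set 'rV[R]_(n i))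
    (f : blockvec R n -> R) (h : forall i, 'rV[R]_(n i) -> R)
    (z z' : blockvec R n) : Prop :=
  exists y : forall i, 'rV[R]_(n i),
    (forall i, argmin (S i) (fun w => surrogate p lambda f h w z) (y i)) /\
    match rule with
    | Jacobian => forall i, submxrow z' i = y i
    | MBI =>
        let decrease i := surrogate p lambda f h (submxrow z i) z
                          - surrogate p lambda f h (y i) z in
        exists i0, argmax [set: 'I_d] decrease i0 /\
          submxrow z' i0 = y i0 /\
          (forall i, i != i0 -> submxrow z' i = submxrow z i)
    end.

(* The iterates are x 1, x 2, ...; the value x 0 is irrelevant. *)
Definition generated (R : realType) (rule : update_rule) (p lambda : R)
    (d : nat) (n : 'I_d -> nat) (S : forall i, set 'rV[R]_(n i))
    (f : blockvec R n -> R) (h : forall i, 'rV[R]_(n i) -> R)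
    (x : nat -> blockvec R n) : Prop :=
  prod_set S (x 1%N) /\
  forall k, (1 <= k)%N -> iteration rule p lambda S f h (x k) (x k.+1).

(* Main.v *)
Require Import Defs.
From mathcomp Require Import all_boot all_order all_algebra.
From mathcomp Require Import all_classical all_reals all_analysis.
From mathcomp Require Import ring lra.
Import Order.TTheory GRing.Theory Num.Theory.
Import numFieldNormedType.Exports.
Local Open Scope classical_set_scope.
Local Open Scope ring_scope.

(** The proof is a sufficient-decrease argument.

    Write [D] for [diam_upper p S `^ p * lambda].  Suppose that [z] is not
    [eps]-stationary, so that some block [i] and some [y] in [S i] make the
    linearised change of [Phi] less than [- eps].  Move only a fraction [t] of
    the way from the block [z_i] towards [y]: by convexity of [h i] the
    linearised decrease is still more than [t * eps], while the penalty
    [lambda / 2 * |t (y - z_i)|_p^p] is at most [t^p * D / 2].  The choice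
    [t = (eps / D)^(q - 1)] is the one for which [t^p * D = t * eps]
    ([optimal_step]), and it leaves a decrease of the surrogate of more than
    [t * eps / 2 = eps^q / (2 * D^(q - 1))].  The bound on [eps] serves to make
    [t] at most 1.

    This decrease is passed on to [Phi].  The descent bound and the additivity
    of the dot product and of the [p]-th power of the [p]-norm over the blocks
    give [Phi z' <= Phi z] minus the sum over all blocks of the surrogate
    decreases realised by [z'] ([Phi_le_sum_surrogate_gaps]).  All these
    decreases are nonnegative.  Under the Jacobian rule the sum contains the
    best decrease in block [i]; under the maximum improvement rule it is the
    largest of all the best decreases.  Either way [Phi] gains at least what any
    single-block move would have gained in its surrogate ([iteration_gain]), so
    a nonstationary iterate loses more than [eps^q / (2 * D^(q - 1))]
    ([nonstationary_gain]).  As [Phi] stays above [Phi_star], this cannot happen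
    [max 1 N] times in a row.

    [Phi_star] is an infimum, so the last step needs [Phi] to be bounded below
    on the feasible set ([Phi_has_lbound]).  The smooth part is continuous; for
    the convex parts it is enough that a convex function on R^m is bounded below
    on every box ([convex_box_lbound]). *)

Set Implicit Arguments.
Unset Strict Implicit.

(** * Convexity and boundedness *)

Lemma convex_functionP (R : realType) (m : nat) (g : 'rV[R]_m -> R) :
  convex_function [set: 'rV[R]_m] g ->
  forall (t : R) (u v : 'rV[R]_m), 0 <= t -> t <= 1 ->
    g (t *: u + (1 - t) *: v) <= t * g u + (1 - t) * g v.
Proof.
move=> cg t u v t0 t1.
by have := cg (Itv01 t0 t1) u v; rewrite !in_setT => /(_ isT isT).
Qed.

Lemma convex_setP (R : realType) (m : nat) (A : set 'rV[R]_m) :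
  convex_set A ->
  forall (t : R) (u v : 'rV[R]_m), 0 <= t -> t <= 1 -> A u -> A v ->
    A (t *: u + (1 - t) *: v).
Proof.
move=> cA t u v t0 t1 /mem_set Au /mem_set Av.
exact/set_mem/(cA u v (Itv01 t0 t1)).
Qed.

Lemma compact_coord_bounded (R : realType) (m : nat) (A : set 'rV[R]_m) :
  compact A -> exists M : R, forall v, A v -> forall j, `|v 0 j| <= M.
Proof.
move=> /compact_bounded /ex_strict_bound_gt0 [M _ AM].
exists M => v Av j.
have /ltW : `|v| < M by exact: AM.
apply: le_trans; rewrite [leRHS]/Num.norm /= mx_normrE.
by rewrite (le_bigmax 0 (fun ij : 'I_1 * 'I_m => `|v ij.1 ij.2|) (0, j)).
Qed.

Section ConvexBounds.
Variables (R : realType) (m : nat) (g : 'rV[R]_m -> R).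
Hypothesis g_convex : convex_function [set: 'rV[R]_m] g.

(** The segment from [- M *: u] to [M *: u] has its values below the larger end
    value; the sum of absolute values is a bound without case distinction. *)
Lemma convex_segment_ubound (u : 'rV[R]_m) (s M : R) : `|s| <= M ->
  g (s *: u) <= `|g (M *: u)| + `|g (- M *: u)|.
Proof.
move=> sM.
have [M0|M0] := eqVneq M 0.
  move: sM; rewrite M0 normr_le0 => /eqP ->.
  by rewrite (le_trans (ler_norm _))// lerDl.
have Mgt0 : 0 < M by rewrite lt_neqAle eq_sym M0 (le_trans (normr_ge0 s)).
move: sM; rewrite ler_norml => /andP[sM1 sM2].
pose t := (s + M) / (2 * M).
have t0 : 0 <= t by rewrite divr_ge0//; lra.
have t1 : t <= 1 by rewrite ler_pdivrMr ?mulr_gt0//; lra.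
have -> : s *: u = t *: (M *: u) + (1 - t) *: (- M *: u).
  by rewrite !scalerA -scalerDl; congr (_ *: _); rewrite /t; field.
apply: le_trans (convex_functionP g_convex (M *: u) (- M *: u) t0 t1) _.
by apply: lerD; (apply: (@le_trans _ _ (1 * `|g _|)); last by rewrite mul1r);
  (apply: le_trans (ler_wpM2l _ (ler_norm _)) _; first lra);
  apply: ler_wpM2r => //; lra.
Qed.

(** Induction on the number of coordinates involved: a vector is the midpoint of
    the doubles of its first coordinate and of the rest.  Doubling enlarges the
    box, which is why the induction runs over all [M] at once. *)
Lemma convex_box_ubound (M : R) :
  exists C, forall v : 'rV[R]_m, (forall j, `|v 0 j| <= M) -> g v <= C.
Proof.
suff [C gC] : exists C, forall a : 'I_m -> R, (forall j, `|a j| <= M) ->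
    g (\sum_j a j *: delta_mx 0 j) <= C.
  by exists C => v vM; rewrite (row_sum_delta v); exact: gC.
(* the enumeration of the coordinates becomes an arbitrary list of them *)
elim: (index_enum 'I_m) M => [|k r IHr] M.
  by exists (g 0) => a _; rewrite big_nil.
have [C gC] := IHr (2 * M).
pose e : 'rV[R]_m := delta_mx 0 k.
exists (2^-1 * (`|g ((2 * M) *: e)| + `|g (- (2 * M) *: e)|) + (1 - 2^-1) * C).
move=> a aM; rewrite big_cons.
have a2M j : `|2 * a j| <= 2 * M.
  by rewrite normrM ger0_norm// ler_pM2l.
(* the sum is the midpoint of its doubled head and its doubled tail *)
have -> : a k *: delta_mx 0 k + \sum_(j <- r) a j *: delta_mx 0 j =
    2^-1 *: ((2 * a k) *: e)
    + (1 - 2^-1) *: (\sum_(j <- r) (2 * a j) *: delta_mx 0 j) :> 'rV[R]_m.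
  rewrite scaler_sumr scalerA mulKf ?pnatr_eq0//; congr (_ + _).
  by apply: eq_bigr => j _; rewrite scalerA; congr (_ *: _); field.
apply: le_trans (convex_functionP g_convex _ _ _ _) _; [lra|lra|].
apply: lerD; apply: ler_wpM2l; [lra| |lra|].
- exact: convex_segment_ubound.
- exact: gC.
Qed.

(** The box is symmetric and 0 is the midpoint of [v] and [- v], so an upper
    bound at [- v] and the value at 0 bound [g v] from below. *)
Lemma convex_box_lbound (M : R) :
  exists c, forall v : 'rV[R]_m, (forall j, `|v 0 j| <= M) -> c <= g v.
Proof.
have [C gC] := convex_box_ubound M.
exists (2 * g 0 - C) => v vM.
have gN : g (- v) <= C by apply: gC => j; rewrite mxE normrN.
have := convex_functionP g_convex (t := 2^-1) v (- v).
have -> : 2^-1 *: v + (1 - 2^-1) *: - v = 0.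
  by rewrite scalerN -scalerBl [X in X *: _](_ : _ = 0) ?scale0r//; field.
by move=> /(_ ltac:(lra) ltac:(lra)); lra.
Qed.

End ConvexBounds.

Lemma continuous_box_lbound (R : realType) (m : nat) (g : 'rV[R]_m -> R)
    (M : R) : 0 <= M -> continuous g ->
  exists c, forall v : 'rV[R]_m, (forall j, `|v 0 j| <= M) -> c <= g v.
Proof.
move=> M0 cg.
pose box := [set v : 'rV[R]_m | forall j, `[- M, M]%classic (v 0 j)].
have box_compact : compact box.
  apply: (@rV_compact R m (fun=> `[- M, M]%classic)) => j.
  exact: segment_compact.
have box_nonempty : box !=set0.
  by exists 0 => j; rewrite /= mxE in_itv /= M0 oppr_le0 M0.
have [c _ cmin] := EVT_min_rV box_nonempty box_compact
  (@continuous_subspaceT _ _ box g cg).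
exists (g c) => v vM; apply: cmin; apply/mem_set => j.
by rewrite /= in_itv /= -ler_norml.
Qed.

(** * Dot product and p-norm *)

Lemma dotp0r (R : realType) (m : nat) (u : 'rV[R]_m) : dotp u 0 = 0.
Proof. by rewrite /dotp big1// => j _; rewrite mxE mulr0. Qed.

Lemma dotpZr (R : realType) (m : nat) (t : R) (u v : 'rV[R]_m) :
  dotp u (t *: v) = t * dotp u v.
Proof.
by rewrite /dotp mulr_sumr; apply: eq_bigr => j _; rewrite mxE mulrCA.
Qed.

Lemma pnorm_powR (R : realType) (p : R) (m : nat) (v : 'rV[R]_m) : 0 < p ->
  pnorm p v `^ p = \sum_j `|v 0 j| `^ p.
Proof.
move=> p0; rewrite /pnorm -powRrM mulVf ?gt_eqF// powRr1//.
by apply: sumr_ge0 => j _; exact: powR_ge0.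
Qed.

Lemma pnorm_powR0 (R : realType) (p : R) (m : nat) : 0 < p ->
  pnorm p (0 : 'rV[R]_m) `^ p = 0.
Proof.
move=> p0; rewrite pnorm_powR// big1// => j _.
by rewrite mxE normr0 powR0// gt_eqF.
Qed.

Lemma pnorm_powRZ (R : realType) (p t : R) (m : nat) (v : 'rV[R]_m) :
  0 < p -> 0 <= t -> pnorm p (t *: v) `^ p = t `^ p * pnorm p v `^ p.
Proof.
move=> p0 t0; rewrite [LHS]pnorm_powR//.
rewrite [in RHS](pnorm_powR v p0) mulr_sumr; apply: eq_bigr => j _.
by rewrite mxE normrM (ger0_norm t0) powRM.
Qed.

(** * Decomposition into blocks *)

Section Blocks.
Variables (R : realType) (d : nat) (n : 'I_d -> nat).

Lemma sum_blocks (F : 'I_(\sum_i n i) -> R) :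
  \sum_s F s = \sum_i \sum_j F (@tagnat.Rank _ n i j).
Proof.
rewrite sig_big_dep/= (reindex _ (@tagnat.sig_bij_on _ n))/=.
by apply: eq_bigr => s _; rewrite -tagnat.rankE tagnat.sigK.
Qed.

Lemma dotp_blocks (u v : blockvec R n) :
  dotp u v = \sum_i dotp (submxrow u i) (submxrow v i).
Proof.
rewrite /dotp sum_blocks; apply: eq_bigr => i _.
by apply: eq_bigr => j _; rewrite !mxE.
Qed.

Lemma pnorm_powR_blocks (p : R) (v : blockvec R n) : 0 < p ->
  pnorm p v `^ p = \sum_i pnorm p (submxrow v i) `^ p.
Proof.
move=> p0; rewrite pnorm_powR// sum_blocks; apply: eq_bigr => i _.
by rewrite pnorm_powR//; apply: eq_bigr => j _; rewrite !mxE.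
Qed.

Lemma coord_block (v : blockvec R n) (s : 'I_(\sum_i n i)) :
  v 0 s = submxrow v (tagnat.sig1 s) 0 (tagnat.sig2 s).
Proof. by rewrite !mxE tagnat.sig2K. Qed.

End Blocks.

(** * Diameters *)

Section Diameters.
Variables (R : realType) (p : R).
Hypothesis p_gt0 : 0 < p.

Lemma pnorm_le_diam (m : nat) (A : set 'rV[R]_m) : compact A ->
  forall u v, A u -> A v -> pnorm p (u - v) <= diam p A.
Proof.
move=> /compact_coord_bounded [M AM] u v Au Av.
apply: ub_le_sup; last by exists u => //; exists v.
exists ((\sum_(j < m) (M + M) `^ p) `^ p^-1) => _ [a Aa [b Ab <-]].
rewrite /pnorm ge0_ler_powR ?nnegrE ?invr_ge0 ?(ltW p_gt0)//.
- by apply: sumr_ge0 => j _; exact: powR_ge0.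
- by apply: sumr_ge0 => j _; exact: powR_ge0.
apply: ler_sum => j _.
have abM : `|(a - b) 0 j| <= M + M.
  by rewrite !mxE (le_trans (ler_normB _ _))// lerD ?AM.
by rewrite ge0_ler_powR ?nnegrE ?(ltW p_gt0)// (le_trans _ abM).
Qed.

Lemma diam_ge0 (m : nat) (A : set 'rV[R]_m) :
  compact A -> A !=set0 -> 0 <= diam p A.
Proof.
by move=> cA [u Au]; apply: le_trans (pnorm_le_diam cA Au Au);
  exact: powR_ge0.
Qed.

Variables (d : nat) (n : 'I_d -> nat) (S : forall i, set 'rV[R]_(n i)).
Arguments S : clear implicits.
Hypothesis S_compact : forall i, compact (S i).
Arguments S_compact : clear implicits.

Lemma diam_lower_powR_le : (forall i, S i !=set0) ->
  diam_lower p S `^ p <= diam_upper p S `^ p.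
Proof.
move=> S_nonempty.
have lower_ge0 : 0 <= diam_lower p S.
  apply: le_bigmin => [|i _]; first by apply/bigmax_geP; left.
  exact: diam_ge0 (S_compact i) (S_nonempty i).
have le_upper : diam_lower p S <= diam_upper p S by exact: bigmin_le_id.
by rewrite ge0_ler_powR ?nnegrE ?(ltW p_gt0)// (le_trans lower_ge0).
Qed.

Lemma pnorm_powR_le_diam_upper i (u v : 'rV[R]_(n i)) : S i u -> S i v ->
  pnorm p (u - v) `^ p <= diam_upper p S `^ p.
Proof.
move=> Su Sv.
have uv_le : pnorm p (u - v) <= diam_upper p S.
  apply: le_trans (pnorm_le_diam (S_compact i) Su Sv) _.
  exact: (le_bigmax 0 (fun i => diam p (S i)) i).
have uv0 : 0 <= pnorm p (u - v) by exact: powR_ge0.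
by rewrite ge0_ler_powR ?nnegrE ?(ltW p_gt0)// (le_trans uv0).
Qed.

End Diameters.

(** * The step length *)

Section StepSize.
Variables (R : realType) (p q : R).
Hypotheses (p_gt1 : 1 < p) (pq : p^-1 + q^-1 = 1).

Lemma conjugate_exponentB1 : (q - 1) * (p - 1) = 1.
Proof.
have p0 : p != 0 by rewrite gt_eqF// (lt_trans ltr01).
have q0 : q != 0.
  apply/eqP => q0; move: pq; rewrite q0 invr0 addr0 => /(congr1 GRing.inv).
  by rewrite invrK invr1 => p1; move: p_gt1; rewrite p1 ltxx.
have -> : (q - 1) * (p - 1) = p * q * (1 - (p^-1 + q^-1)) + 1.
  by field; rewrite p0 q0.
by rewrite pq subrr mulr0 add0r.
Qed.

(** The witness is [t = (eps / D)^(q - 1)].  Since [(q - 1) * (p - 1) = 1], its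
    power [t^(p - 1)] is [eps / D]: the penalty [t^p * D / 2] then consumes
    exactly half of the linear gain [t * eps], and the other half is the gain
    per iteration. *)
Lemma optimal_step (eps D : R) : 0 < eps -> eps <= D ->
  exists t, [/\ 0 < t, t <= 1, t `^ p * D = t * eps
             & t * eps / 2 = eps `^ q / (2 * D `^ (q - 1))].
Proof.
move=> e0 eD; have D0 : 0 < D := lt_le_trans e0 eD.
have q1 : 0 <= q - 1.
  have p1 : 0 < p - 1 by rewrite subr_gt0.
  by rewrite -(pmulr_lge0 _ p1) conjugate_exponentB1.
have eD0 : 0 < eps / D by rewrite divr_gt0.
have t0 : 0 < (eps / D) `^ (q - 1) by rewrite powR_gt0.
exists ((eps / D) `^ (q - 1)); split => //.
- apply: (@le_trans _ _ (1 `^ (q - 1))); last by rewrite powR1.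
  by rewrite ge0_ler_powR ?nnegrE ?(ltW eD0)// ler_pdivrMr// mul1r.
- have p0 : 0 < p by rewrite (lt_trans ltr01).
  rewrite -(mulr_powRB1 (ltW t0) p0) -powRrM conjugate_exponentB1.
  rewrite powRr1 ?(ltW eD0)// -mulrA divfK// gt_eqF//.
- rewrite powRM ?(ltW e0) ?invr_ge0 ?(ltW D0)//.
  rewrite -(powR_inv1 (ltW D0)) -powRrM mulN1r powRN.
  have q0 : 0 < q by lra.
  rewrite -(mulr_powRB1 (ltW e0) q0).
  by field; rewrite gt_eqF// powR_gt0.
Qed.

End StepSize.

(** * Decrease of the objective *)

Section BlockDescent.
Variables (R : realType) (d : nat) (n : 'I_d -> nat).
Variables (S : forall i, set 'rV[R]_(n i)).
Variables (f : blockvec R n -> R) (h : forall i, 'rV[R]_(n i) -> R).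
Arguments S : clear implicits.
Arguments h : clear implicits.

(** The feasible set lies in a box, and each summand is bounded below on boxes.
    Boxes spare the proof that a product of compact blocks is compact. *)
Lemma Phi_has_lbound : (forall i, compact (S i)) ->
  (forall x, differentiable f x) ->
  (forall i, convex_function [set: 'rV[R]_(n i)] (h i)) ->
  has_lbound (Phi f h @` prod_set S).
Proof.
move=> S_compact f_diff h_convex.
have [M SM] := choice (fun i => compact_coord_bounded (S_compact i)).
have [c hc] := choice (fun i => convex_box_lbound (h_convex i) (M i)).
pose B := \big[Num.max/0]_i M i.
have B0 : 0 <= B by apply/bigmax_geP; left.
have f_cont : continuous f by move=> x; exact: differentiable_continuous.
have [b fb] := continuous_box_lbound B0 f_cont.
exists (b + \sum_i c i) => _ [x Sx <-].
apply: lerD; last by apply: ler_sum => i _; apply: hc => j; exact: SM.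
apply: fb => s; rewrite coord_block.
apply: le_trans (SM _ _ (Sx _) _) _.
exact: (le_bigmax 0 M (tagnat.sig1 s)).
Qed.

Variables (p lambda : R).
Hypotheses (p_gt1 : 1 < p) (lambda_gt0 : 0 < lambda).
Hypothesis f_descent : descent_bound p lambda S f.

Let p_gt0 : 0 < p. Proof. exact: lt_trans p_gt1. Qed.

Local Notation U w z := (surrogate p lambda f h w z).

Lemma surrogate_self i (z : blockvec R n) :
  U (submxrow z i) z = f z + h i (submxrow z i).
Proof.
by rewrite /surrogate subrr dotp0r pnorm_powR0// mulr0 !addr0.
Qed.

(** After cancelling the common [f z], this is the descent bound split into
    blocks.  Blocks that do not move contribute 0, so both update rules are
    covered. *)
Lemma Phi_le_sum_surrogate_gaps (z z' : blockvec R n) :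
  prod_set S z -> prod_set S z' ->
  Phi f h z' <=
    Phi f h z - \sum_i (U (submxrow z i) z - U (submxrow z' i) z).
Proof.
move=> Sz Sz'.
suff -> : Phi f h z - \sum_i (U (submxrow z i) z - U (submxrow z' i) z) =
    f z + dotp (grad f z) (z' - z) + lambda / 2 * pnorm p (z' - z) `^ p
    + \sum_i h i (submxrow z' i) by rewrite lerD2r; exact: f_descent.
rewrite dotp_blocks pnorm_powR_blocks// mulr_sumr /Phi -!addrA; congr (_ + _).
rewrite -sumrB -!big_split /=; apply: eq_bigr => i _.
rewrite surrogate_self /surrogate submxrowB /block_grad; ring.
Qed.

(** One iteration improves [Phi] at least as much as the best single-block move
    improves its surrogate: the Jacobian sum of nonnegative gaps dominates the
    gap of block [i], and the maximum improvement rule keeps the largest gap. *)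
Lemma iteration_gain rule (z z' : blockvec R n) : prod_set S z ->
  iteration rule p lambda S f h z z' ->
  prod_set S z' /\
  forall i (w : 'rV[R]_(n i)), S i w ->
    Phi f h z' <= Phi f h z - (U (submxrow z i) z - U w z).
Proof.
move=> Sz [y [y_min update]].
pose gap i := U (submxrow z i) z - U (y i) z.
have gap_ge0 i : 0 <= gap i by rewrite subr_ge0; exact: (y_min i).2.
have gap_ge i w : S i w -> U (submxrow z i) z - U w z <= gap i.
  by move=> Sw; rewrite lerD2l lerN2; exact: (y_min i).2.
case: rule update => [z'E|[i0 [[_ i0_max] [z'E0 z'E]]]].
- have Sz' : prod_set S z' by move=> i; rewrite z'E; exact: (y_min i).1.
  split=> // i w Sw; apply: le_trans (Phi_le_sum_surrogate_gaps Sz Sz') _.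
  rewrite lerD2l lerN2; apply: le_trans (gap_ge i w Sw) _.
  rewrite (eq_bigr gap) => [|j _]; last by rewrite z'E.
  by rewrite (bigD1 i)//= lerDl sumr_ge0.
- have Sz' : prod_set S z'.
    move=> i; have [->|ii0] := eqVneq i i0; last by rewrite z'E.
    by rewrite z'E0; exact: (y_min i0).1.
  split=> // i w Sw; apply: le_trans (Phi_le_sum_surrogate_gaps Sz Sz') _.
  rewrite lerD2l lerN2; apply: le_trans (gap_ge i w Sw) _.
  rewrite (bigD1 i0)//= big1 => [|j ji0]; last by rewrite z'E// subrr.
  by rewrite addr0 z'E0; exact: i0_max.
Qed.

(** Along the segment from [z_i] to [y] the linear part is proportional to [t],
    convexity bounds the change of [h i] by its proportional part, and the
    penalty is homogeneous of degree [p]. *)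
Lemma surrogate_gap_segment i (z : blockvec R n) (y : 'rV[R]_(n i)) (t : R) :
  convex_function [set: 'rV[R]_(n i)] (h i) -> 0 <= t -> t <= 1 ->
  - (t * (dotp (block_grad f i z) (y - submxrow z i)
          + h i y - h i (submxrow z i)))
  - t `^ p * (lambda * pnorm p (y - submxrow z i) `^ p) / 2
  <= U (submxrow z i) z - U (t *: y + (1 - t) *: submxrow z i) z.
Proof.
move=> h_convex t0 t1; rewrite surrogate_self.
have -> : U (t *: y + (1 - t) *: submxrow z i) z =
    f z + t * dotp (block_grad f i z) (y - submxrow z i)
    + lambda / 2 * (t `^ p * pnorm p (y - submxrow z i) `^ p)
    + h i (t *: y + (1 - t) *: submxrow z i).
  rewrite /surrogate.
  have -> : t *: y + (1 - t) *: submxrow z i - submxrow z i =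
      t *: (y - submxrow z i) by apply/rowP => j; rewrite !mxE; ring.
  by congr (_ + _ + _ * _ + _); [exact: dotpZr|exact: pnorm_powRZ].
have := convex_functionP h_convex y (submxrow z i) t0 t1.
(* what remains is the convexity inequality up to rearrangement *)
move: (h i _) (h i y) (h i (submxrow z i)) => a b c.
move: (dotp _ _) (pnorm _ _ `^ _) (t `^ p) => u v s; lra.
Qed.

Variables (q eps : R).
Hypotheses (pq : p^-1 + q^-1 = 1) (eps_gt0 : 0 < eps).
Hypothesis eps_le : eps <= diam_upper p S `^ p * lambda.
Hypothesis S_compact : forall i, compact (S i).
Arguments S_compact : clear implicits.
Hypothesis S_convex : forall i, convex_set (S i).
Hypothesis h_convex : forall i, convex_function [set: 'rV[R]_(n i)] (h i).

(** Test [iteration_gain] with the point at fraction [t] on the segment towards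
    a [y] that violates stationarity, for the [t] of [optimal_step]. *)
Lemma nonstationary_gain rule (z z' : blockvec R n) : prod_set S z ->
  iteration rule p lambda S f h z z' -> ~ stationary S f h eps z ->
  Phi f h z' + eps `^ q / (2 * (diam_upper p S `^ p * lambda) `^ (q - 1))
    < Phi f h z.
Proof.
move=> Sz zz'; rewrite ltNge => z_nonstat; apply/negP => small_gain.
apply: z_nonstat; split => // i y Sy; rewrite leNgt; apply/negP => y_descends.
have [t [t0 t1 tpD tE]] := optimal_step p_gt1 pq eps_gt0 eps_le.
have /(iteration_gain Sz zz').2 : S i (t *: y + (1 - t) *: submxrow z i).
  by apply: (convex_setP (@S_convex i)) => //; exact: ltW.
have := surrogate_gap_segment z y (@h_convex i) (ltW t0) t1.
have quad : t `^ p * (lambda * pnorm p (y - submxrow z i) `^ p) <= t * eps.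
  rewrite -tpD ler_wpM2l ?powR_ge0// mulrC ler_wpM2r ?(ltW lambda_gt0)//.
  by apply: pnorm_powR_le_diam_upper.
move: y_descends; rewrite -(ltr_pM2l t0) mulrN => y_descends.
move: small_gain; rewrite -tE.
lra.
Qed.

End BlockDescent.

(** * The iteration bound *)

Unset Implicit Arguments.
Set Strict Implicit.

Theorem theorem5p3 (R : realType) (d : nat) (hd : (0 < d)%N)
    (n : 'I_d -> nat)
    (S : forall i, set 'rV[R]_(n i))
    (S_nonempty : forall i, S i !=set0)
    (S_convex : forall i, convex_set (S i))
    (S_compact : forall i, compact (S i))
    (f : blockvec R n -> R)
    (f_diff : forall x : blockvec R n, differentiable f x)
    (h : forall i, 'rV[R]_(n i) -> R)
    (h_convex : forall i, convex_function [set: 'rV[R]_(n i)] (h i))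
    (p q lambda : R) (p_gt1 : 1 < p) (lambda_gt0 : 0 < lambda)
    (pq : p^-1 + q^-1 = 1)
    (f_descent : descent_bound p lambda S f)
    (eps : R) (eps_gt0 : 0 < eps)
    (eps_lt : eps < diam_lower p S `^ p * lambda)
    (rule : update_rule) (x : nat -> blockvec R n)
    (x_gen : generated rule p lambda S f h x) :
  let N : int :=
    Num.ceil (2 * (diam_upper p S `^ p * lambda) `^ (q - 1)
              * (Phi f h (x 1%N) - Phi_star S f h) / eps `^ q) in
  exists k : nat,
    [/\ (1 <= k)%N, k%:Z <= Num.max 1 N & stationary S f h eps (x k)].
Proof.
set D := diam_upper p S `^ p * lambda.
move=> N; apply: contrapT => no_stationary.
have p_gt0 : 0 < p := lt_trans ltr01 p_gt1.
have eps_le : eps <= D.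
  apply: le_trans (ltW eps_lt) _; rewrite ler_pM2r//.
  exact: diam_lower_powR_le.
have [x1S x_step] := x_gen.
pose delta := eps `^ q / (2 * D `^ (q - 1)).
pose m := `|Num.max 1%R N|%N.
have mE : m%:Z = Num.max 1 N by rewrite gez0_abs// le_max ler01.
have m_gt0 : (0 < m)%N by rewrite -ltz_nat mE lt_max ltr01.
have gain k : (1 <= k <= m)%N -> prod_set S (x k) ->
    Phi f h (x k.+1) + delta < Phi f h (x k).
  move=> /andP[k1 km] Sxk; apply: nonstationary_gain (x_step k k1) _ => //.
  by move=> stat; apply: no_stationary; exists k; rewrite -mE lez_nat.
have xS k : (1 <= k)%N -> prod_set S (x k).
  case: k => // k _; elim: k => // k IHk.
  by have [] := iteration_gain p_gt1 f_descent IHk (x_step k.+1 isT).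
have telescope k : (k < m)%N ->
    Phi f h (x k.+1) + k%:R * delta <= Phi f h (x 1%N).
  elim: k => [|k IHk] km; first by rewrite mul0r addr0.
  have := gain k.+1; rewrite (ltnW km) => /(_ isT (xS k.+1 isT)) gain_k.
  have := IHk (ltnW km); rewrite -natr1; lra.
have Phi_star_le : Phi_star S f h <= Phi f h (x m.+1).
  apply: ge_inf; first exact: Phi_has_lbound.
  by exists (x m.+1) => //; exact: xS.
have total_gain : m%:R * delta < Phi f h (x 1%N) - Phi_star S f h.
  have := telescope m.-1; rewrite prednK// => /(_ (leqnn m)) tele.
  have := gain m; rewrite m_gt0 leqnn => /(_ isT (xS m m_gt0)).
  have -> : m%:R = m.-1%:R + 1 :> R by rewrite natr1 prednK.
  lra.
have D0 : 0 < D `^ (q - 1) by rewrite powR_gt0// (lt_le_trans eps_gt0).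
have e0 : 0 < eps `^ q by rewrite powR_gt0.
have : 2 * D `^ (q - 1) * (Phi f h (x 1%N) - Phi_star S f h) / eps `^ q <= m%:R.
  apply: le_trans (ceil_ge _) _.
  have -> : m%:R = m%:Z%:~R :> R by [].
  by rewrite -/N mE ler_int le_max lexx orbT.
apply/negP; rewrite -ltNge ltr_pdivlMr// -ltr_pdivrMl ?mulr_gt0//.
by move: total_gain; rewrite /delta mulrCA mulrA mulrC [X in _ * X]mulrC.
Qed.
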